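(* Let $X$ be a represented space, let $Y$ be a computable metric space and let $g$ be a multi-valued function on represented spaces. If $f:\subseteq X\to Y$ is single-valued and $f\leq_{\mathrm W}\mathsf{C}_{\{0,1\}^{\mathbb{N}}}\times g$, then $f\leq_{\mathrm W}g$.
   Context: Baire space is $\mathbb{N}^{\mathbb{N}}$, with its usual product topology and a fixed computable bijective pairing $\langle\cdot,\cdot\rangle$ on it. Computability of partial functions $F:\subseteq\mathbb{N}^{\mathbb{N}}\to\mathbb{N}^{\mathbb{N}}$ is meant via (type-2) Turing machines. A representation of a set $X$ is a surjective partial function $\delta:\subseteq\mathbb{N}^{\mathbb{N}}\to X$; $(X,\delta)$ is a represented space. $f:\subseteq X\rightrightarrows Y$ denotes a partial multi-valued function ($f(x)\neq\emptyset$ for $x\in\mathrm{dom}(f)$). A realizer of $f:\subseteq(X,\delta_X)\rightrightarrows(Y,\delta_Y)$, written $F\vdash f$, is a single-valued $F:\subseteq\mathbb{N}^{\mathbb{N}}\to\mathbb{N}^{\mathbb{N}}$ with $\delta_Y F(p)\in f\delta_X(p)$ for all $p\in\mathrm{dom}(f\delta_X)$. Weihrauch reducibility $f\leq_{\mathrm W}g$ means: there are computable $K,H:\subseteq\mathbb{N}^{\mathbb{N}}\to\mathbb{N}^{\mathbb{N}}$ such that $p\mapsto K\langle p,GH(p)\rangle$ is a realizer of $f$ for every $G\vdash g$. $\{0,1\}^{\mathbb{N}}$ is represented by the restricted identity. $\mathcal{A}_-(\{0,1\}^{\mathbb{N}})$ is the set of closed subsets of Cantor space with the representation $\psi_-$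 in which $p$ names $A$ iff $p$ is a (potentially empty) enumeration of words $w_i\in\{0,1\}^*$ with $A=\{0,1\}^{\mathbb{N}}\setminus\bigcup_i w_i\{0,1\}^{\mathbb{N}}$. Closed choice is $\mathsf{C}_{\{0,1\}^{\mathbb{N}}}:\subseteq\mathcal{A}_-(\{0,1\}^{\mathbb{N}})\rightrightarrows\{0,1\}^{\mathbb{N}},\ A\mapsto A$ with domain the non-empty closed sets (any point of $A$ is an admissible output). The product of multi-valued functions is $(f\times g)(x,w)=f(x)\times g(w)$, with pairs named by $\langle p,q\rangle$ where $p,q$ name the components. A computable metric space $(Y,d,\alpha)$ is a separable metric space with a numbering $\alpha:\mathbb{N}\to Y$ of a countable dense subset such that $(i,j)\mapsto d(\alpha(i),\alpha(j))$ is computable; it is represented by its Cauchy representation ($p$ names $\lim_i\alpha(p(i))$ provided $d(\alpha(p(i)),\alpha(p(j)))<2^{-j}$ for all $i>j$). *)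

(* Defs.v *)
From Stdlib Require Import Arith ZArith Lia List Cantor.
From Stdlib Require Import Reals Lra.
From Stdlib Require Import Classical ClassicalEpsilon.
From Stdlib Require Import FunctionalExtensionality PropExtensionality ProofIrrelevance.

Open Scope nat_scope.

Definition baire : Type := nat -> nat.

Definition npair (a b : nat) : nat := Cantor.to_nat (a, b).
Definition nfst (n : nat) : nat := fst (Cantor.of_nat n).
Definition nsnd (n : nat) : nat := snd (Cantor.of_nat n).

(** Programs of oracle machines, presented as Kleene's partial recursive
    functionals. Functions of several arguments are unary functions of Cantor
    pairs; [Oracle] queries the infinite input sequence. *)
Inductive code : Type :=
| Zero | Succ | Fst | Snd | Oracle
| Pair (c d : code)
| Comp (c d : code)
| Rec (c d : code)
| Mu (c : code).

(** [eval p c n m]: with infinite input [p], program [c] halts on [n] with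
    result [m]. For [Mu], all values before the first zero must be defined. *)
Fixpoint eval (p : baire) (c : code) (n m : nat) : Prop :=
  match c with
  | Zero => m = 0
  | Succ => m = S n
  | Fst => m = nfst n
  | Snd => m = nsnd n
  | Oracle => m = p n
  | Pair c d => exists a b, eval p c n a /\ eval p d n b /\ m = npair a b
  | Comp c d => exists a, eval p d n a /\ eval p c a m
  | Rec c d =>
      (fix rec (k r : nat) : Prop :=
         match k with
         | 0 => eval p c (nfst n) r
         | S k' => exists s, rec k' s /\ eval p d (npair (nfst n) (npair k' s)) r
         end) (nsnd n) m
  | Mu c => eval p c (npair n m) 0 /\
            forall i, i < m -> exists k, eval p c (npair n i) (S k)
  end.

Record pfun : Type := {
  graph :> baire -> baire -> Prop;
  graph_functional : forall p q q', graph p q -> graph p q' -> q = q'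
}.

(** A single program outputs [F p], digit by digit, for all [p] in the domain
    of [F]; nothing is required outside the domain. *)
Definition computable (F : pfun) : Prop :=
  exists c, forall p q, F p q -> forall n, eval p c n (q n).

(** Oracle-free computability: the constant zero oracle gives no information. *)
Definition computable_nat (h : nat -> nat) : Prop :=
  exists c, forall n, eval (fun _ => 0) c n (h n).

Definition bpair (p q : baire) : baire := fun n => npair (p n) (q n).
Definition bfst (r : baire) : baire := fun n => nfst (r n).
Definition bsnd (r : baire) : baire := fun n => nsnd (r n).

Lemma bfst_pair p q : bfst (bpair p q) = p.
Proof.
  apply functional_extensionality; intro n; unfold bfst, bpair, nfst, npair.
  now rewrite Cantor.cancel_of_to.
Qed.

Lemma bsnd_pair p q : bsnd (bpair p q) = q.
Proof.
  apply functional_extensionality; intro n; unfold bsnd, bpair, nsnd, npair.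
  now rewrite Cantor.cancel_of_to.
Qed.

Lemma bpair_surj r : bpair (bfst r) (bsnd r) = r.
Proof.
  apply functional_extensionality; intro n.
  unfold bfst, bsnd, bpair, nfst, nsnd, npair.
  now rewrite <- surjective_pairing, Cantor.cancel_to_of.
Qed.

(** [names p x] is the graph of the representation. *)
Record represented_space : Type := {
  carrier :> Type;
  names : baire -> carrier -> Prop;
  names_functional : forall p x y, names p x -> names p y -> x = y;
  names_surjective : forall x, exists p, names p x
}.

Arguments names {_} _ _.

(** A partial multi-valued function is given by its graph; [x] belongs to its
    domain exactly when it has some value. *)
Definition multifun (X Y : represented_space) : Type := X -> Y -> Prop.

Definition mdom {X Y : represented_space} (f : multifun X Y) (x : X) : Prop :=
  exists y, f x y.

Definition single_valued {X Y : represented_space} (f : multifun X Y) : Prop :=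
  forall x y y', f x y -> f x y' -> y = y'.

Definition realizes {X Y : represented_space} (F : pfun) (f : multifun X Y) : Prop :=
  forall (p : baire) (x : X), names p x -> mdom f x ->
  exists (q : baire) (y : Y), F p q /\ names q y /\ f x y.

Lemma wcomp_functional (K G H : pfun) p q q' :
  (exists h r, H p h /\ G h r /\ K (bpair p r) q) ->
  (exists h r, H p h /\ G h r /\ K (bpair p r) q') -> q = q'.
Proof.
  intros (h & r & Hh & Gr & Kq) (h' & r' & Hh' & Gr' & Kq').
  rewrite (graph_functional H _ _ _ Hh' Hh) in Gr'.
  rewrite (graph_functional G _ _ _ Gr' Gr) in Kq'.
  exact (graph_functional K _ _ _ Kq Kq').
Qed.

Definition wcomp (K G H : pfun) : pfun := {|
  graph := fun p q => exists h r, H p h /\ G h r /\ K (bpair p r) q;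
  graph_functional := wcomp_functional K G H
|}.

Definition weihrauch_le {X Y Z W : represented_space}
    (f : multifun X Y) (g : multifun Z W) : Prop :=
  exists K H : pfun, computable K /\ computable H /\
    forall G : pfun, realizes G g -> realizes (wcomp K G H) f.

Definition prod_names {X Y : represented_space} (r : baire) (z : X * Y) : Prop :=
  exists p q, r = bpair p q /\ names p (fst z) /\ names q (snd z).

Lemma prod_names_functional {X Y : represented_space} r (z z' : X * Y) :
  prod_names r z -> prod_names r z' -> z = z'.
Proof.
  destruct z as [x y], z' as [x' y'].
  intros (p & q & E & Hx & Hy) (p' & q' & E' & Hx' & Hy'); cbn in *.
  assert (p' = p) by now rewrite <- (bfst_pair p q), <- (bfst_pair p' q'), <- E, E'.
  assert (q' = q) by now rewrite <- (bsnd_pair p q), <- (bsnd_pair p' q'), <- E, E'.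
  subst; f_equal; eapply names_functional; eauto.
Qed.

Lemma prod_names_surjective {X Y : represented_space} (z : X * Y) :
  exists r, prod_names r z.
Proof.
  destruct z as [x y].
  destruct (names_surjective X x) as [p Hp], (names_surjective Y y) as [q Hq].
  now exists (bpair p q), p, q.
Qed.

Definition prod_space (X Y : represented_space) : represented_space := {|
  carrier := X * Y;
  names := prod_names;
  names_functional := prod_names_functional;
  names_surjective := prod_names_surjective
|}.

Definition multifun_prod {X Y Z W : represented_space}
    (f : multifun X Y) (g : multifun Z W) :
    multifun (prod_space X Z) (prod_space Y W) :=
  fun u v => f (fst u) (fst v) /\ g (snd u) (snd v).

Definition cantor : Type := nat -> bool.

Definition cantor_names (p : baire) (x : cantor) : Prop :=
  forall n, p n = Nat.b2n (x n).

Lemma cantor_names_functional p x y :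
  cantor_names p x -> cantor_names p y -> x = y.
Proof.
  intros Hx Hy; apply functional_extensionality; intro n.
  apply Nat.b2n_inj; now rewrite <- Hx, <- Hy.
Qed.

Lemma cantor_names_surjective x : exists p, cantor_names p x.
Proof. now exists (fun n => Nat.b2n (x n)). Qed.

Definition cantor_space : represented_space := {|
  carrier := cantor;
  names := cantor_names;
  names_functional := cantor_names_functional;
  names_surjective := cantor_names_surjective
|}.

(** Closed for the product topology: every point of the complement has a basic
    neighbourhood contained in the complement. *)
Definition closed_cantor (A : cantor -> Prop) : Prop :=
  forall x, ~ A x -> exists n, forall y, (forall k, k < n -> y k = x k) -> ~ A y.

(** Binary digits, least significant first, without the leading [1]; this is a
    bijection from [positive] onto the binary words. *)
Fixpoint word_of_pos (u : positive) : list bool :=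
  match u with
  | xH => nil
  | xO u' => false :: word_of_pos u'
  | xI u' => true :: word_of_pos u'
  end.

(** The entry [0] of an enumeration lists no word, so that the empty
    enumeration is allowed. *)
Definition listed_word (m : nat) : option (list bool) :=
  match N.of_nat m with
  | N0 => None
  | Npos u => Some (word_of_pos u)
  end.

Definition is_prefix (w : list bool) (x : cantor) : Prop :=
  map x (seq 0 (length w)) = w.

Definition closed_set : Type := {A : cantor -> Prop | closed_cantor A}.

Definition psi_minus (p : baire) (A : closed_set) : Prop :=
  forall x, proj1_sig A x <->
    ~ exists i w, listed_word (p i) = Some w /\ is_prefix w x.

Lemma psi_minus_functional p A B : psi_minus p A -> psi_minus p B -> A = B.
Proof.
  destruct A as [A HA], B as [B HB]; unfold psi_minus; cbn; intros EA EB.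
  assert (A = B) as ->.
  { apply functional_extensionality; intro x.
    apply propositional_extensionality; now rewrite EA, EB. }
  now rewrite (proof_irrelevance _ HA HB).
Qed.

Lemma word_of_pos_surjective w : exists u, word_of_pos u = w.
Proof.
  induction w as [|[] w [u <-]].
  - now exists xH.
  - now exists (xI u).
  - now exists (xO u).
Qed.

Lemma listed_word_surjective w : exists m, listed_word m = Some w.
Proof.
  destruct (word_of_pos_surjective w) as [u <-]; exists (Pos.to_nat u).
  unfold listed_word; now rewrite positive_nat_N.
Qed.

Lemma is_prefix_map x n : is_prefix (map x (seq 0 n)) x.
Proof. unfold is_prefix; now rewrite length_map, length_seq. Qed.

Lemma is_prefix_map_agree x y n :
  is_prefix (map x (seq 0 n)) y -> forall k, k < n -> y k = x k.
Proof.
  unfold is_prefix; rewrite length_map, length_seq; intros E k Hk.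
  apply (ext_in_map E), in_seq; lia.
Qed.

Lemma psi_minus_surjective A : exists p, psi_minus p A.
Proof.
  destruct A as [A HA].
  set (P m := exists w, listed_word m = Some w /\ forall x, is_prefix w x -> ~ A x).
  exists (fun m => if excluded_middle_informative (P m) then m else 0).
  intro x; cbn; split.
  - intros Ax (i & w & Hw & Hx).
    destruct (excluded_middle_informative (P i)) as [(w' & Hw' & HP)|_].
    + rewrite Hw' in Hw; injection Hw as ->. exact (HP x Hx Ax).
    + discriminate.
  - intro Hx; apply NNPP; intro nAx; apply Hx.
    destruct (HA x nAx) as [n Hn].
    destruct (listed_word_surjective (map x (seq 0 n))) as [m Hm].
    exists m, (map x (seq 0 n)).
    destruct (excluded_middle_informative (P m)) as [_|nP].
    + split; [exact Hm | apply is_prefix_map].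
    + exfalso; apply nP; exists (map x (seq 0 n)); split; [exact Hm|].
      intros y Hy; apply Hn, is_prefix_map_agree, Hy.
Qed.

Definition closed_space : represented_space := {|
  carrier := closed_set;
  names := psi_minus;
  names_functional := psi_minus_functional;
  names_surjective := psi_minus_surjective
|}.

Definition closed_choice : multifun closed_space cantor_space :=
  fun A x => proj1_sig A x.

(** The triple code [<<a, b>, c>] stands for the rational [(a - b) / (c + 1)]. *)
Definition rational_of_nat (m : nat) : R :=
  ((INR (nfst (nfst m)) - INR (nsnd (nfst m))) / (INR (nsnd m) + 1))%R.

(** A double sequence of reals is computable when rational approximations with
    error below [2^-k] can be computed uniformly in the indices and [k]. *)
Definition computable_real_double (a : nat -> nat -> R) : Prop :=
  exists h, computable_nat h /\
    forall i j k,
      (Rabs (rational_of_nat (h (npair i (npair j k))) - a i j) < (/ 2) ^ k)%R.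

Record computable_metric_space : Type := {
  cms_metric :> Metric_Space;
  cms_points : nat -> Base cms_metric;
  cms_dense : forall (y : Base cms_metric) (e : R), (0 < e)%R ->
    exists i, (dist cms_metric (cms_points i) y < e)%R;
  cms_computable : computable_real_double
    (fun i j => dist cms_metric (cms_points i) (cms_points j))
}.

Definition cauchy_names (Y : computable_metric_space) (p : baire) (y : Base Y) : Prop :=
  (forall i j, j < i ->
     (dist Y (cms_points Y (p i)) (cms_points Y (p j)) < (/ 2) ^ j)%R) /\
  Un_cv (fun i => dist Y (cms_points Y (p i)) y) 0%R.

Lemma cauchy_names_functional Y p y z :
  cauchy_names Y p y -> cauchy_names Y p z -> y = z.
Proof.
  intros [_ Hy] [_ Hz]; apply (dist_refl Y).
  destruct (Rle_lt_or_eq_dec 0 (dist Y y z)) as [D|D];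
    [apply Rge_le, dist_pos | | now symmetry].
  exfalso.
  destruct (Hy (dist Y y z / 2)%R) as [M HM]; [lra|].
  destruct (Hz (dist Y y z / 2)%R) as [N HN]; [lra|].
  specialize (HM (M + N) ltac:(lia)); specialize (HN (M + N) ltac:(lia)).
  unfold Rdist in HM, HN; rewrite Rminus_0_r in HM, HN.
  apply Rabs_def2 in HM; apply Rabs_def2 in HN.
  pose proof (dist_tri Y y z (cms_points Y (p (M + N)))) as T.
  rewrite (dist_sym Y y (cms_points Y (p (M + N)))) in T; lra.
Qed.

Lemma cauchy_names_surjective Y y : exists p, cauchy_names Y p y.
Proof.
  assert (D : forall n, {i | (dist Y (cms_points Y i) y < (/ 2) ^ S n)%R}).
  { intro n; apply constructive_indefinite_description, cms_dense, pow_lt; lra. }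
  exists (fun n => proj1_sig (D n)); split.
  - intros i j Hij.
    destruct (D i) as [a Hi], (D j) as [b Hj]; simpl in *.
    pose proof (dist_tri Y (cms_points Y a) (cms_points Y b) y) as T.
    rewrite (dist_sym Y y) in T.
    assert ((/ 2) ^ S i <= (/ 2) ^ S j)%R.
    { rewrite !pow_inv.
      apply Rinv_le_contravar; [apply pow_lt; lra | apply Rle_pow; [lra | lia]]. }
    simpl in H; lra.
  - intros e He.
    destruct (pow_lt_1_zero (/ 2) ltac:(rewrite Rabs_pos_eq; lra) e He) as [N HN].
    exists N; intros n Hn.
    destruct (D n) as [a Hi]; simpl proj1_sig; specialize (HN (S n) ltac:(lia)).
    unfold Rdist; rewrite Rminus_0_r, Rabs_pos_eq by apply Rge_le, dist_pos.
    rewrite Rabs_pos_eq in HN by (apply pow_le; lra); lra.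
Qed.

Definition cauchy_space (Y : computable_metric_space) : represented_space := {|
  carrier := Base Y;
  names := cauchy_names Y;
  names_functional := cauchy_names_functional Y;
  names_surjective := cauchy_names_surjective Y
|}.

(* Main.v *)
Require Import Defs.
From Stdlib Require Import Arith ZArith Lia List Cantor Bool.
From Stdlib Require Import Reals Lra.
From Stdlib Require Import Classical ClassicalEpsilon FunctionalExtensionality.
Import ListNotations.
Open Scope nat_scope.

(** A choice of a point of Cantor space can be eliminated because Cantor space
    is compact and the final answer is unique.

    Let [K] and [H] witness the reduction of [f] to the product of closed choice
    and [g], and let [p] name a point of the domain of [f]. Then [H p] consists of
    a name [a] of a non-empty closed set [A] and a name of an instance of [g]
    ([weihrauch_inputs]). A solution [v] of that instance is available in the
    reduction to [g]; a point of [A] is not. But for every point [x] of [A]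
    the sequence [K (p, (x, v))] is a Cauchy name of one and the same point [y],
    the value of [f]. An approximation of [y] can hence be found by trying all
    [x] at once. Search for a stage [s] and a dense point [i] such that, for
    each binary word of length [s], either a word that [a] lists before stage [s]
    is a prefix of it, or [K], reading only this word and with all its unbounded
    searches cut off at [s], outputs a term that is close to [i].

    - If the search succeeds, [i] is close to [y]: some word is a prefix of a
      point of [A], and for this word only the second alternative can hold
      ([settled_sound]).
    - The search succeeds: each point of Cantor space outside [A] is eventually
      covered, and on each point of [A] the machine halts after reading a
      finite prefix; by compactness one stage serves all points
      ([cantor_compact], [settled_everywhere]).

    That the search can be carried out by a program is shown by closure
    properties of the functions that programs compute ([cmp]). The program [K]
    is fixed, so its bounded simulation [beval] is defined by recursion
    on the syntax of [K], and no universal machine enters ([cmp_beval]). *)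

(** * Programs and their oracles *)

#[local] Arguments nfst : simpl never.
#[local] Arguments nsnd : simpl never.
#[local] Arguments npair : simpl never.

Lemma nfst_npair a b : nfst (npair a b) = a.
Proof. unfold nfst, npair; now rewrite Cantor.cancel_of_to. Qed.

Lemma nsnd_npair a b : nsnd (npair a b) = b.
Proof. unfold nsnd, npair; now rewrite Cantor.cancel_of_to. Qed.

Lemma npair_surj n : npair (nfst n) (nsnd n) = n.
Proof.
  unfold nfst, nsnd, npair.
  now rewrite <- surjective_pairing, Cantor.cancel_to_of.
Qed.

Lemma eval_functional p c : forall n m m', eval p c n m -> eval p c n m' -> m = m'.
Proof.
  induction c as [ | | | | |c IHc d IHd|c IHc d IHd|c IHc d IHd|c IHc];
    intros n m m'; cbn; try congruence.
  - intros (a & b & Ha & Hb & ->) (a' & b' & Ha' & Hb' & ->); f_equal; eauto.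
  - intros (a & Ha & Hm) (a' & Ha' & Hm').
    rewrite (IHd _ _ _ Ha' Ha) in Hm'; eauto.
  - revert m m'; induction (nsnd n) as [|k IHk]; intros m m'; [apply IHc|].
    intros (s & Hs & Hm) (s' & Hs' & Hm').
    rewrite (IHk _ _ Hs' Hs) in Hm'; eauto.
  - intros [H0 HS] [H0' HS'].
    destruct (lt_eq_lt_dec m m') as [[L|E]|L]; [exfalso|exact E|exfalso].
    + destruct (HS' _ L) as [k Hk]; discriminate (IHc _ _ _ H0 Hk).
    + destruct (HS _ L) as [k Hk]; discriminate (IHc _ _ _ H0' Hk).
Qed.

Definition pfun_of_code (c : code) : pfun.
Proof.
  refine {| graph := fun p q => forall n, eval p c n (q n) |}.
  intros p q q' Hq Hq'; apply functional_extensionality; intro n.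
  eapply eval_functional; eauto.
Defined.

Lemma computable_pfun_of_code c : computable (pfun_of_code c).
Proof. exists c; auto. Qed.

(** Replacing oracle calls by a subprogram serves twice: to run [H], which reads
    [p], on the oracle [bpair p v], and to run oracle-free programs on any oracle. *)
Fixpoint relativize (d c : code) : code :=
  match c with
  | Oracle => d
  | Pair a b => Pair (relativize d a) (relativize d b)
  | Comp a b => Comp (relativize d a) (relativize d b)
  | Rec a b => Rec (relativize d a) (relativize d b)
  | Mu a => Mu (relativize d a)
  | c => c
  end.

Lemma eval_relativize p q d c : (forall n, eval p d n (q n)) ->
  forall n m, eval q c n m -> eval p (relativize d c) n m.
Proof.
  intro Hd.
  induction c as [ | | | | |c IHc d' IHd|c IHc d' IHd|c IHc d' IHd|c IHc];
    intros n m; cbn; auto.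
  - intros ->; apply Hd.
  - intros (a & b & Ha & Hb & ->); exists a, b; auto.
  - intros (a & Ha & Hb); exists a; auto.
  - revert m; induction (nsnd n) as [|k IHk]; intro m; [apply IHc|].
    intros (s & Hs & Hm); exists s; split; [apply IHk, Hs | apply IHd, Hm].
  - intros [H0 HS]; split; [auto|].
    intros i Hi; destruct (HS i Hi) as [k Hk]; eauto.
Qed.

(** * Computability in a context *)

(** A context is a type of environments, each with an oracle and with the number
    that programs receive as input. Since a function of the environment is
    computed by one program for all environments, computability in a context
    is uniform. Restricting the type of environments to valid data lets
    algorithms be described by total functions although the programs involved
    may diverge on other data. *)
Record ctx : Type := {
  ctx_env :> Type;
  ctx_oracle : ctx_env -> baire;
  ctx_index : ctx_env -> nat
}.

(** Binding one more numerical variable, as needed for the bodies of recursions,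
    quantifiers and searches. *)
Definition ext (C : ctx) : ctx := {|
  ctx_env := C * nat;
  ctx_oracle := fun e => ctx_oracle C (fst e);
  ctx_index := fun e => npair (ctx_index C (fst e)) (snd e)
|}.

Definition cmp (C : ctx) (f : C -> nat) : Prop :=
  exists c, forall e, eval (ctx_oracle C e) c (ctx_index C e) (f e).

Definition cmpb (C : ctx) (b : C -> bool) : Prop := cmp C (fun e => Nat.b2n (b e)).

Lemma cmp_ext (C : ctx) (f g : C -> nat) :
  (forall e, f e = g e) -> cmp C f -> cmp C g.
Proof. intros E [c Hc]; exists c; intro e; rewrite <- E; apply Hc. Qed.

Lemma cmp_index (C : ctx) : cmp C (ctx_index C).
Proof.
  exists (Pair Fst Snd); intro e; cbn; do 2 eexists; split; [|split]; auto.
  symmetry; apply npair_surj.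
Qed.

Lemma cmp_subst (C D : ctx) (s : D -> C) (f : C -> nat) :
  (forall e, ctx_oracle C (s e) = ctx_oracle D e) ->
  cmp D (fun e => ctx_index C (s e)) -> cmp C f -> cmp D (fun e => f (s e)).
Proof.
  intros Ho [d Hd] [c Hc]; exists (Comp c d); intro e; cbn.
  exists (ctx_index C (s e)); split; [apply Hd | rewrite <- Ho; apply Hc].
Qed.

Lemma cmp_last (C : ctx) : cmp (ext C) (fun e => snd e).
Proof. exists Snd; intro e; cbn; now rewrite nsnd_npair. Qed.

Lemma cmp_weak (C : ctx) (f : C -> nat) : cmp C f -> cmp (ext C) (fun e => f (fst e)).
Proof.
  apply (cmp_subst C (ext C) fst); [reflexivity|].
  exists Fst; intro e; cbn; now rewrite nfst_npair.
Qed.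

(** Calling a subroutine that was shown computable in the context [C] from a
    context [D] that extends [C] along the projection [s]. *)
Lemma cmp_call (C D : ctx) (s : D -> C) (f : C -> nat -> nat) (n : D -> nat) :
  (forall e, ctx_oracle C (s e) = ctx_oracle D e) ->
  cmp D (fun e => ctx_index C (s e)) ->
  cmp (ext C) (fun e => f (fst e) (snd e)) -> cmp D n ->
  cmp D (fun e => f (s e) (n e)).
Proof.
  intros Ho [i Hi] Hf [c Hc].
  refine (cmp_subst (ext C) D (fun e => (s e, n e)) (fun e => f (fst e) (snd e)) Ho _ Hf).
  exists (Pair i c); intro e; cbn; eauto 6.
Qed.

Lemma cmp_const (C : ctx) k : cmp C (fun _ => k).
Proof.
  induction k as [|k [c Hc]]; [now exists Zero|].
  exists (Comp Succ c); intro e; cbn; eauto.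
Qed.

Lemma cmp_S (C : ctx) (f : C -> nat) : cmp C f -> cmp C (fun e => S (f e)).
Proof. intros [c Hc]; exists (Comp Succ c); intro e; cbn; eauto. Qed.

Lemma cmp_nfst (C : ctx) (f : C -> nat) : cmp C f -> cmp C (fun e => nfst (f e)).
Proof. intros [c Hc]; exists (Comp Fst c); intro e; cbn; eauto. Qed.

Lemma cmp_nsnd (C : ctx) (f : C -> nat) : cmp C f -> cmp C (fun e => nsnd (f e)).
Proof. intros [c Hc]; exists (Comp Snd c); intro e; cbn; eauto. Qed.

Lemma cmp_npair (C : ctx) (f g : C -> nat) :
  cmp C f -> cmp C g -> cmp C (fun e => npair (f e) (g e)).
Proof. intros [c Hc] [d Hd]; exists (Pair c d); intro e; cbn; eauto 6. Qed.

Lemma cmp_oracle (C : ctx) (f : C -> nat) :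
  cmp C f -> cmp C (fun e => ctx_oracle C e (f e)).
Proof. intros [c Hc]; exists (Comp Oracle c); intro e; cbn; eauto. Qed.

Lemma cmp_computable_nat (C : ctx) h (f : C -> nat) :
  computable_nat h -> cmp C f -> cmp C (fun e => h (f e)).
Proof.
  intros [c Hc] [d Hd]; exists (Comp (relativize Zero c) d); intro e; cbn.
  exists (f e); split; [apply Hd|].
  apply (eval_relativize _ (fun _ => 0)); [now cbn | apply Hc].
Qed.

(** The program for [Rec] passes the input as [<e, <k, r>>], whereas the context
    of the step expects [<<e, k>, r>]; hence the rebracketing in the witness. *)
Lemma cmp_rec (C : ctx) (b n : C -> nat) (f : C -> nat -> nat -> nat) :
  cmp C b -> cmp C n ->
  cmp (ext (ext C)) (fun e => f (fst (fst e)) (snd (fst e)) (snd e)) ->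
  cmp C (fun e => nat_rect (fun _ => nat) (b e) (f e) (n e)).
Proof.
  intros [cb Hb] [cn Hn] [cf Hf].
  exists (Comp (Rec cb (Comp cf (Pair (Pair Fst (Comp Fst Snd)) (Comp Snd Snd))))
            (Pair (Pair Fst Snd) cn)).
  intro e.
  exists (npair (ctx_index C e) (n e)); split.
  - exists (ctx_index C e), (n e); repeat split; auto.
    do 2 eexists; split; [|split]; cbn; auto; now rewrite npair_surj.
  - cbn; rewrite nfst_npair, nsnd_npair.
    induction (n e) as [|k IHk]; [apply Hb|].
    eexists; split; [exact IHk|].
    exists (npair (npair (ctx_index C e) k) (nat_rect (fun _ => nat) (b e) (f e) k)).
    split; [|exact (Hf (e, k, _))].
    do 2 eexists; split; [|split; [|reflexivity]].
    + do 2 eexists; split; [|split; [|reflexivity]]; cbn.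
      * now rewrite nfst_npair.
      * eexists; split; [reflexivity|]; now rewrite nsnd_npair, nfst_npair.
    + eexists; split; [reflexivity|]; cbn; now rewrite !nsnd_npair.
Qed.

Lemma cmp_case (C : ctx) (b n : C -> nat) (f : C -> nat -> nat) :
  cmp C n -> cmp C b -> cmp (ext C) (fun e => f (fst e) (snd e)) ->
  cmp C (fun e => match n e with 0 => b e | S k => f e k end).
Proof.
  intros Hn Hb Hf.
  apply cmp_ext with (fun e => nat_rect (fun _ => nat) (b e) (fun k _ => f e k) (n e)).
  - intro e; now destruct (n e).
  - exact (cmp_rec C b n (fun e k _ => f e k) Hb Hn (cmp_weak _ _ Hf)).
Qed.

(** Unification does not find the weakenings by itself; these tactics try nested
    weakenings of a given proof, compared up to conversion. *)
Ltac cmp_weaken_upto n H :=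
  first [ exact H
        | lazymatch n with
          | S ?k => let H' := constr:(cmp_weak _ _ H) in cmp_weaken_upto k H'
          end ].

Ltac cmp_weaken H := cmp_weaken_upto 6 H.

Ltac cmp_var :=
  first [ exact (cmp_last _)
        | exact (cmp_weak _ _ (cmp_last _))
        | exact (cmp_weak _ _ (cmp_weak _ _ (cmp_last _)))
        | exact (cmp_weak _ _ (cmp_weak _ _ (cmp_weak _ _ (cmp_last _))))
        | exact (cmp_weak _ _ (cmp_weak _ _ (cmp_weak _ _ (cmp_weak _ _ (cmp_last _))))) ].

Lemma cmp_pred (C : ctx) (f : C -> nat) : cmp C f -> cmp C (fun e => pred (f e)).
Proof.
  intro Hf; apply cmp_ext with (fun e => match f e with 0 => 0 | S k => k end).
  - intro e; now destruct (f e).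
  - apply (cmp_case C (fun _ => 0) f (fun _ k => k) Hf); [apply cmp_const | apply cmp_last].
Qed.

Lemma cmp_add (C : ctx) (f g : C -> nat) :
  cmp C f -> cmp C g -> cmp C (fun e => f e + g e).
Proof.
  intros Hf Hg.
  apply cmp_ext with (fun e => nat_rect (fun _ => nat) (g e) (fun _ r => S r) (f e)).
  - intro e; induction (f e) as [|k IH]; cbn; congruence.
  - apply (cmp_rec C g f (fun _ _ r => S r) Hg Hf), cmp_S, cmp_last.
Qed.

Lemma cmp_mul (C : ctx) (f g : C -> nat) :
  cmp C f -> cmp C g -> cmp C (fun e => f e * g e).
Proof.
  intros Hf Hg.
  apply cmp_ext with (fun e => nat_rect (fun _ => nat) 0 (fun _ r => g e + r) (f e)).
  - intro e; induction (f e) as [|k IH]; cbn; congruence.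
  - apply (cmp_rec C (fun _ => 0) f (fun e _ r => g e + r)); [apply cmp_const|exact Hf|].
    apply cmp_add; [cmp_weaken Hg | apply cmp_last].
Qed.

Lemma cmp_pow2 (C : ctx) (f : C -> nat) : cmp C f -> cmp C (fun e => 2 ^ f e).
Proof.
  intro Hf.
  apply cmp_ext with (fun e => nat_rect (fun _ => nat) 1 (fun _ r => 2 * r) (f e)).
  - intro e; induction (f e) as [|k IH]; cbn in *; congruence.
  - apply (cmp_rec C (fun _ => 1) f (fun _ _ r => 2 * r)); [apply cmp_const|exact Hf|].
    apply cmp_mul; [apply cmp_const | apply cmp_last].
Qed.

Lemma cmp_sub (C : ctx) (f g : C -> nat) :
  cmp C f -> cmp C g -> cmp C (fun e => f e - g e).
Proof.
  intros Hf Hg.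
  apply cmp_ext with (fun e => nat_rect (fun _ => nat) (f e) (fun _ r => pred r) (g e)).
  - intro e; induction (g e) as [|k IH]; cbn in *; lia.
  - apply (cmp_rec C f g (fun _ _ r => pred r) Hf Hg), cmp_pred, cmp_last.
Qed.

Lemma cmpb_ltb (C : ctx) (f g : C -> nat) :
  cmp C f -> cmp C g -> cmpb C (fun e => f e <? g e).
Proof.
  intros Hf Hg.
  apply cmp_ext with (fun e => match g e - f e with 0 => 0 | S _ => 1 end).
  - intro e; destruct (Nat.ltb_spec (f e) (g e)), (g e - f e) eqn:E; cbn; lia.
  - apply (cmp_case C (fun _ => 0) (fun e => g e - f e) (fun _ _ => 1));
      [now apply cmp_sub | apply cmp_const | apply cmp_const].
Qed.

Lemma cmp_if (C : ctx) (b : C -> bool) (f g : C -> nat) :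
  cmpb C b -> cmp C f -> cmp C g -> cmp C (fun e => if b e then f e else g e).
Proof.
  intros Hb Hf Hg.
  apply cmp_ext with (fun e => match Nat.b2n (b e) with 0 => g e | S _ => f e end).
  - intro e; now destruct (b e).
  - apply (cmp_case C g (fun e => Nat.b2n (b e)) (fun e _ => f e) Hb Hg).
    now apply cmp_weak.
Qed.

Lemma cmpb_if (C : ctx) (b c d : C -> bool) :
  cmpb C b -> cmpb C c -> cmpb C d -> cmpb C (fun e => if b e then c e else d e).
Proof.
  intros Hb Hc Hd.
  apply cmp_ext with (2 := cmp_if C b _ _ Hb Hc Hd); intro e; now destruct (b e).
Qed.

Lemma cmpb_const (C : ctx) (b : bool) : cmpb C (fun _ => b).
Proof. exact (cmp_const C (Nat.b2n b)). Qed.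

Lemma cmpb_orb (C : ctx) (b c : C -> bool) :
  cmpb C b -> cmpb C c -> cmpb C (fun e => b e || c e).
Proof. intros Hb Hc; apply (cmpb_if C b _ c Hb (cmpb_const C true) Hc). Qed.

Lemma cmpb_negb (C : ctx) (b : C -> bool) : cmpb C b -> cmpb C (fun e => negb (b e)).
Proof. intro Hb; apply (cmpb_if C b _ _ Hb (cmpb_const C _) (cmpb_const C _)). Qed.

Lemma cmpb_eqb (C : ctx) (f g : C -> nat) :
  cmp C f -> cmp C g -> cmpb C (fun e => f e =? g e).
Proof.
  intros Hf Hg.
  apply cmp_ext with (fun e => Nat.b2n (negb ((f e <? g e) || (g e <? f e)))).
  - intro e; f_equal.
    destruct (Nat.ltb_spec (f e) (g e)), (Nat.ltb_spec (g e) (f e)),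
      (Nat.eqb_spec (f e) (g e)); cbn; lia.
  - apply cmpb_negb, cmpb_orb; now apply cmpb_ltb.
Qed.

Lemma cmpb_existsb (C : ctx) (n : C -> nat) (b : C -> nat -> bool) :
  cmp C n -> cmpb (ext C) (fun e => b (fst e) (snd e)) ->
  cmpb C (fun e => existsb (b e) (seq 0 (n e))).
Proof.
  intros Hn Hb.
  apply cmp_ext with (fun e => nat_rect (fun _ => nat) 0
    (fun k r => if b e k then 1 else r) (n e)).
  - intro e; induction (n e) as [|k IH]; [reflexivity|].
    rewrite seq_S, existsb_app; cbn [nat_rect]; rewrite IH; cbn.
    now destruct (b e k), (existsb (b e) (seq 0 k)).
  - apply (cmp_rec C (fun _ => 0) n (fun e k r => if b e k then 1 else r));
      [apply cmp_const | exact Hn |].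
    apply cmp_if; [apply (cmp_weak _ _ Hb) | apply cmp_const | apply cmp_last].
Qed.

Lemma cmpb_forallb (C : ctx) (n : C -> nat) (b : C -> nat -> bool) :
  cmp C n -> cmpb (ext C) (fun e => b (fst e) (snd e)) ->
  cmpb C (fun e => forallb (b e) (seq 0 (n e))).
Proof.
  intros Hn Hb.
  apply cmp_ext with (fun e => nat_rect (fun _ => nat) 1
    (fun k r => if b e k then r else 0) (n e)).
  - intro e; induction (n e) as [|k IH]; [reflexivity|].
    rewrite seq_S, forallb_app; cbn [nat_rect]; rewrite IH; cbn.
    now destruct (b e k), (forallb (b e) (seq 0 k)).
  - apply (cmp_rec C (fun _ => 1) n (fun e k r => if b e k then r else 0));
      [apply cmp_const | exact Hn |].
    apply cmp_if; [apply (cmp_weak _ _ Hb) | apply cmp_last | apply cmp_const].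
Qed.

Lemma cmpb_odd (C : ctx) (f : C -> nat) : cmp C f -> cmpb C (fun e => Nat.odd (f e)).
Proof.
  intro Hf.
  apply cmp_ext with (fun e => nat_rect (fun _ => nat) 0 (fun _ r => 1 - r) (f e)).
  - intro e; induction (f e) as [|k IH]; [reflexivity|].
    cbn [nat_rect]; rewrite IH, Nat.odd_succ, <- Nat.negb_odd.
    now destruct (Nat.odd k).
  - apply (cmp_rec C (fun _ => 0) f (fun _ _ r => 1 - r));
      [apply cmp_const | exact Hf |].
    apply cmp_sub; [apply cmp_const | apply cmp_last].
Qed.

Lemma div2_succ k : Nat.div2 (S k) = Nat.div2 k + Nat.b2n (Nat.odd k).
Proof.
  pose proof (Nat.div2_odd k) as E; pose proof (Nat.div2_odd (S k)) as E'.
  rewrite Nat.odd_succ, <- Nat.negb_odd in E'.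
  destruct (Nat.odd k); cbn [negb Nat.b2n] in *; lia.
Qed.

Lemma cmp_div2 (C : ctx) (f : C -> nat) : cmp C f -> cmp C (fun e => Nat.div2 (f e)).
Proof.
  intro Hf.
  apply cmp_ext with (fun e => nat_rect (fun _ => nat) 0
    (fun k r => r + Nat.b2n (Nat.odd k)) (f e)).
  - intro e; induction (f e) as [|k IH]; [reflexivity|].
    cbn [nat_rect]; now rewrite IH, div2_succ.
  - apply (cmp_rec C (fun _ => 0) f (fun _ k r => r + Nat.b2n (Nat.odd k)));
      [apply cmp_const | exact Hf |].
    apply cmp_add; [apply cmp_last |].
    apply cmpb_odd; apply (cmp_weak _ _ (cmp_last C)).
Qed.

Lemma cmpb_testbit (C : ctx) (f g : C -> nat) :
  cmp C f -> cmp C g -> cmpb C (fun e => Nat.testbit (f e) (g e)).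
Proof.
  intros Hf Hg.
  apply cmp_ext with (fun e => Nat.b2n (Nat.odd
    (nat_rect (fun _ => nat) (f e) (fun _ r => Nat.div2 r) (g e)))).
  - intro e; f_equal.
    generalize (f e) as a; clear - C; induction (g e) as [|k IH]; intro a; [reflexivity|].
    cbn [nat_rect Nat.testbit]; rewrite <- IH; f_equal.
    clear; induction k as [|k IH]; cbn in *; congruence.
  - apply cmpb_odd, (cmp_rec C f g (fun _ _ r => Nat.div2 r) Hf Hg), cmp_div2, cmp_last.
Qed.

(** Only the total boolean test need be computable: where the search always
    succeeds, the least solution is a total function of the environment. *)
Lemma cmp_search (C : ctx) (b : C -> nat -> bool) :
  cmpb (ext C) (fun e => b (fst e) (snd e)) ->
  (forall e, exists t, b e t = true) ->
  exists f, cmp C f /\ forall e, b e (f e) = true.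
Proof.
  intros Hb Hex; destruct (cmpb_negb _ _ Hb) as [c Hc].
  assert (L : forall e, exists t, b e t = true /\ forall i, i < t -> b e i = false).
  { intro e; destruct (Hex e) as [t Ht].
    induction t as [t IH] using lt_wf_ind.
    destruct (classic (exists i, i < t /\ b e i = true)) as [(i & Hi & Bi)|N].
    - exact (IH i Hi Bi).
    - exists t; split; [exact Ht|]; intros i Hi.
      destruct (b e i) eqn:E; [exfalso; eauto | reflexivity]. }
  exists (fun e => proj1_sig (constructive_indefinite_description _ (L e))); split.
  - exists (Mu c); intro e.
    destruct (constructive_indefinite_description _ (L e)) as (t & Bt & Lt); cbn.
    split.
    + specialize (Hc (e, t)); cbn in Hc; now rewrite Bt in Hc.
    + intros i Hi; exists 0.
      specialize (Hc (e, i)); cbn in Hc; now rewrite (Lt i Hi) in Hc.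
  - intro e; now destruct (constructive_indefinite_description _ (L e)) as (t & Bt & Lt).
Qed.

(** * Bounded simulation of a program on a finite part of its oracle *)

(** Results and oracle values are shifted by one, [0] meaning undefined. The
    bound [s] is only consulted by unbounded search, the sole source of
    divergence. The search loop runs through the states [1] (still searching),
    [S (S i)] (zero found at [i]) and [0] (a needed value is undefined), so that
    its predecessor is again a shifted result. *)
Fixpoint beval (q : nat -> nat) (s : nat) (c : code) (n : nat) : nat :=
  match c with
  | Zero => 1
  | Succ => S (S n)
  | Fst => S (nfst n)
  | Snd => S (nsnd n)
  | Oracle => q n
  | Pair c d =>
      match beval q s c n with
      | 0 => 0
      | S a => match beval q s d n with 0 => 0 | S b => S (npair a b) end
      end
  | Comp c d => match beval q s d n with 0 => 0 | S a => beval q s c a end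
  | Rec c d =>
      nat_rect (fun _ => nat) (beval q s c (nfst n))
        (fun k r => match r with
                    | 0 => 0
                    | S a => beval q s d (npair (nfst n) (npair k a))
                    end) (nsnd n)
  | Mu c =>
      pred (nat_rect (fun _ => nat) 1
        (fun k r => match r with
                    | 0 => 0
                    | S r' =>
                        match r' with
                        | 0 => match beval q s c (npair n k) with
                               | 0 => 0
                               | S a => match a with 0 => S (S k) | S _ => 1 end
                               end
                        | S i => S (S i)
                        end
                    end) s)
  end.

Lemma beval_sound p q s c : (forall i a, q i = S a -> a = p i) ->
  forall n m, beval q s c n = S m -> eval p c n m.
Proof.
  intro Hq.
  induction c as [ | | | | |c IHc d IHd|c IHc d IHd|c IHc d IHd|c IHc];
    intros n m; cbn [beval eval]; try congruence; auto.
  - destruct (beval q s c n) as [|a] eqn:Ea; [discriminate|].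
    destruct (beval q s d n) as [|b] eqn:Eb; [discriminate|].
    intro E; injection E as <-; exists a, b; auto.
  - destruct (beval q s d n) as [|a] eqn:Ea; [discriminate|].
    intro E; exists a; auto.
  - revert m; induction (nsnd n) as [|k IHk]; intro m; [apply IHc|].
    cbn [nat_rect].
    destruct (nat_rect _ _ _ k) as [|a]; [discriminate|].
    intro E; exists a; split; [apply IHk; reflexivity | now apply IHd].
  - set (F := nat_rect _ _ _).
    assert (I : forall t, match F t with
        | 0 => True
        | 1 => forall i, i < t -> exists k, eval p c (npair n i) (S k)
        | S (S m) => eval p c (npair n m) 0 /\
                     forall i, i < m -> exists k, eval p c (npair n i) (S k)
        end).
    { induction t as [|t IHt]; [cbn; lia|].
      cbn [F nat_rect]; fold F.
      change (nat_rect _ _ _ t) with (F t).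
      destruct (F t) as [|[|r]]; [exact I | | exact IHt].
      destruct (beval q s c (npair n t)) as [|[|a]] eqn:E; [exact I | auto |].
      intros i Hi; destruct (Nat.eq_dec i t) as [->|]; [eauto | apply IHt; lia]. }
    specialize (I s); destruct (F s) as [|[|r]]; try discriminate.
    cbn; intro E; injection E as <-; exact I.
Qed.

(** The use principle: a halting computation reads finitely much of its oracle,
    hence persists for all larger bounds and all oracles that share this part. *)
Lemma beval_complete p c : forall n m, eval p c n m ->
  exists s0, forall s q, s0 <= s -> (forall i, i < s0 -> q i = S (p i)) ->
    beval q s c n = S m.
Proof.
  induction c as [ | | | | |c IHc d IHd|c IHc d IHd|c IHc d IHd|c IHc];
    intros n m; cbn [beval eval].
  1-4: intros ->; exists 0; auto.
  - intros ->; exists (S n); auto.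
  - intros (a & b & Ha & Hb & ->).
    destruct (IHc _ _ Ha) as [s1 H1], (IHd _ _ Hb) as [s2 H2].
    exists (s1 + s2); intros s q Hs Hq.
    rewrite H1, H2; try lia; intros; apply Hq; lia.
  - intros (a & Ha & Hb).
    destruct (IHd _ _ Ha) as [s1 H1], (IHc _ _ Hb) as [s2 H2].
    exists (s1 + s2); intros s q Hs Hq.
    rewrite H1, H2; try lia; intros; apply Hq; lia.
  - revert m; induction (nsnd n) as [|k IHk]; intro m; [apply IHc|].
    intros (a & Ha & Hb).
    destruct (IHk _ Ha) as [s1 H1], (IHd _ _ Hb) as [s2 H2].
    exists (s1 + s2); intros s q Hs Hq; cbn [nat_rect].
    rewrite H1, H2; try lia; intros; apply Hq; lia.
  - intros [H0 HS].
    destruct (IHc _ _ H0) as [s1 H1].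
    assert (B : exists s2, forall s q, s2 <= s -> (forall i, i < s2 -> q i = S (p i)) ->
      forall i, i < m -> exists k, beval q s c (npair n i) = S (S k)).
    { clear H0 H1; induction m as [|m IHm]; [exists 0; lia|].
      destruct IHm as [s2 H2]; [auto|].
      destruct (HS m) as [k Hk]; [lia|].
      destruct (IHc _ _ Hk) as [s3 H3].
      exists (s2 + s3); intros s q Hs Hq i Hi.
      destruct (Nat.eq_dec i m) as [->|].
      - exists k; apply H3; [lia|]; intros; apply Hq; lia.
      - apply H2; try lia; intros; apply Hq; lia. }
    destruct B as [s2 H2].
    exists (s1 + s2 + S m); intros s q Hs Hq.
    specialize (H1 s q ltac:(lia)); specialize (H2 s q ltac:(lia)).
    apply (f_equal pred (y := S (S m))).
    match goal with |- nat_rect _ _ ?f _ = _ => set (F := nat_rect (fun _ => nat) 1 f) end.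
    assert (L : forall t, t <= m -> F t = 1).
    { induction t as [|t IHt]; [reflexivity|]; intro Ht.
      cbn [F nat_rect]; fold F; change (nat_rect _ _ _ t) with (F t).
      rewrite IHt by lia.
      destruct (H2 ltac:(intros; apply Hq; lia) t ltac:(lia)) as [k ->]; reflexivity. }
    assert (R : forall t, F (S m + t) = S (S m)).
    { induction t as [|t IHt].
      - rewrite Nat.add_0_r.
        cbn [F nat_rect]; fold F; change (nat_rect _ _ _ m) with (F m).
        now rewrite L, H1 by (lia || (intros; apply Hq; lia)).
      - rewrite Nat.add_succ_r.
        cbn [F nat_rect]; fold F; change (nat_rect _ _ _ (S m + t)) with (F (S m + t)).
        now rewrite IHt. }
    replace s with (S m + (s - S m)) by lia; apply R.
Qed.

Lemma cmp_beval (C : ctx) (q : C -> nat -> nat) (s : C -> nat) (c : code) :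
  cmp (ext C) (fun e => q (fst e) (snd e)) -> cmp C s ->
  cmp (ext C) (fun e => beval (q (fst e)) (s (fst e)) c (snd e)).
Proof.
  intros Hq Hs.
  induction c as [ | | | | |c IHc d IHd|c IHc d IHd|c IHc d IHd|c IHc]; cbn [beval].
  - apply cmp_const.
  - apply cmp_S, cmp_S, cmp_last.
  - apply cmp_S, cmp_nfst, cmp_last.
  - apply cmp_S, cmp_nsnd, cmp_last.
  - exact Hq.
  - apply (cmp_case (ext C) (fun _ => 0)
             (fun e => beval (q (fst e)) (s (fst e)) c (snd e))
             (fun e a => match beval (q (fst e)) (s (fst e)) d (snd e) with
                         | 0 => 0 | S b => S (npair a b) end));
      [exact IHc | apply cmp_const |].
    apply (cmp_case (ext (ext C)) (fun _ => 0)
             (fun e => beval (q (fst (fst e))) (s (fst (fst e))) d (snd (fst e)))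
             (fun e b => S (npair (snd e) b)));
      [cmp_weaken IHd | apply cmp_const |].
    apply cmp_S, cmp_npair; cmp_var.
  - apply (cmp_case (ext C) (fun _ => 0)
             (fun e => beval (q (fst e)) (s (fst e)) d (snd e))
             (fun e a => beval (q (fst e)) (s (fst e)) c a));
      [exact IHd | apply cmp_const |].
    apply (cmp_call C (ext (ext C)) (fun e => fst (fst e))
             (fun e a => beval (q e) (s e) c a) (fun e => snd e));
      [reflexivity | cmp_weaken (cmp_index C) | exact IHc | apply cmp_last].
  - apply (cmp_rec (ext C)
             (fun e => beval (q (fst e)) (s (fst e)) c (nfst (snd e)))
             (fun e => nsnd (snd e))
             (fun e k r => match r with
                | 0 => 0
                | S a => beval (q (fst e)) (s (fst e)) d
                           (npair (nfst (snd e)) (npair k a)) end)).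
    + apply (cmp_call C (ext C) fst (fun e a => beval (q e) (s e) c a)
               (fun e => nfst (snd e)));
        [reflexivity | cmp_weaken (cmp_index C) | exact IHc | apply cmp_nfst, cmp_last].
    + apply cmp_nsnd, cmp_last.
    + apply (cmp_case (ext (ext (ext C))) (fun _ => 0) (fun e => snd e)
               (fun e a => beval (q (fst (fst (fst e)))) (s (fst (fst (fst e)))) d
                  (npair (nfst (snd (fst (fst e)))) (npair (snd (fst e)) a))));
        [apply cmp_last | apply cmp_const |].
      apply (cmp_call C (ext (ext (ext (ext C)))) (fun e => fst (fst (fst (fst e))))
               (fun e a => beval (q e) (s e) d a)
               (fun e => npair (nfst (snd (fst (fst (fst e)))))
                               (npair (snd (fst (fst e))) (snd e))));
        [reflexivity | cmp_weaken (cmp_index C) | exact IHd |].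
      apply cmp_npair; [apply cmp_nfst | apply cmp_npair];
        cmp_var.
  - apply cmp_pred.
    apply (cmp_rec (ext C) (fun _ => 1) (fun e => s (fst e))
             (fun e k r => match r with
                    | 0 => 0
                    | S r' =>
                        match r' with
                        | 0 => match beval (q (fst e)) (s (fst e)) c (npair (snd e) k) with
                               | 0 => 0
                               | S a => match a with 0 => S (S k) | S _ => 1 end
                               end
                        | S i => S (S i)
                        end
                    end)); [apply cmp_const | cmp_weaken Hs |].
    apply (cmp_case (ext (ext (ext C))) (fun _ => 0) (fun e => snd e)
             (fun e r' => match r' with
                | 0 => match beval (q (fst (fst (fst e)))) (s (fst (fst (fst e)))) c
                               (npair (snd (fst (fst e))) (snd (fst e))) with
                       | 0 => 0
                       | S a => match a with 0 => S (S (snd (fst e))) | S _ => 1 end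
                       end
                | S i => S (S i)
                end)); [apply cmp_last | apply cmp_const |].
    apply (cmp_case (ext (ext (ext (ext C))))
             (fun e => match beval (q (fst (fst (fst (fst e))))) (s (fst (fst (fst (fst e))))) c
                               (npair (snd (fst (fst (fst e)))) (snd (fst (fst e)))) with
                       | 0 => 0
                       | S a => match a with 0 => S (S (snd (fst (fst e)))) | S _ => 1 end
                       end)
             (fun e => snd e) (fun _ i => S (S i)));
      [apply cmp_last | | apply cmp_S, cmp_S, cmp_last].
    apply (cmp_case (ext (ext (ext (ext C)))) (fun _ => 0)
             (fun e => beval (q (fst (fst (fst (fst e))))) (s (fst (fst (fst (fst e))))) c
                               (npair (snd (fst (fst (fst e)))) (snd (fst (fst e)))))
             (fun e a => match a with 0 => S (S (snd (fst (fst e)))) | S _ => 1 end));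
      [ | apply cmp_const | ].
    + apply (cmp_call C (ext (ext (ext (ext C)))) (fun e => fst (fst (fst (fst e))))
               (fun e a => beval (q e) (s e) c a)
               (fun e => npair (snd (fst (fst (fst e)))) (snd (fst (fst e)))));
        [reflexivity | cmp_weaken (cmp_index C) | exact IHc |].
      apply cmp_npair; cmp_var.
    + apply (cmp_case (ext (ext (ext (ext (ext C)))))
               (fun e => S (S (snd (fst (fst (fst e)))))) (fun e => snd e) (fun _ _ => 1));
        [apply cmp_last | apply cmp_S, cmp_S | apply cmp_const].
      cmp_var.
Qed.

(** * Words, cylinders and compactness *)

(** The number under which the prefix of [x] of length [l] is listed: its binary
    digits are those of the prefix, with a leading one. The recursion adds the
    next digit by moving the leading one up: from [2^k] to [2^(k+1)] the increase
    is [2^k], plus [2^k] for a digit one. *)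
Definition prefix_number (x : cantor) (l : nat) : nat :=
  nat_rect (fun _ => nat) 1 (fun k r => r + 2 ^ k * S (Nat.b2n (x k))) l.

Lemma prefix_number_succ x l :
  prefix_number x (S l) = Nat.b2n (x 0) + 2 * prefix_number (fun k => x (S k)) l.
Proof.
  induction l as [|l IH]; [cbn; lia|].
  change (prefix_number x (S (S l)))
    with (prefix_number x (S l) + 2 ^ S l * S (Nat.b2n (x (S l)))).
  change (prefix_number (fun k => x (S k)) (S l))
    with (prefix_number (fun k => x (S k)) l + 2 ^ l * S (Nat.b2n (x (S l)))).
  rewrite IH, Nat.pow_succ_r'; lia.
Qed.

Lemma prefix_number_agree x y l :
  (forall k, k < l -> x k = y k) -> prefix_number x l = prefix_number y l.
Proof.
  induction l as [|l IH]; intro E; [reflexivity|].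
  cbn [prefix_number nat_rect]; fold (prefix_number x l) (prefix_number y l).
  rewrite IH, E; auto.
Qed.

Lemma prefix_number_positive x l : 0 < prefix_number x l.
Proof. induction l as [|l IH]; [apply Nat.lt_0_1 | apply Nat.add_pos_l, IH]. Qed.

Lemma map_seq_shift (x : cantor) i n :
  map x (seq (S i) n) = map (fun k => x (S k)) (seq i n).
Proof. now rewrite <- seq_shift, map_map. Qed.

Lemma is_prefix_word_of_pos x u :
  is_prefix (word_of_pos u) x <-> exists l, Pos.to_nat u = prefix_number x l.
Proof.
  revert x; induction u as [u IH|u IH|]; intro x.
  - unfold is_prefix in *; cbn [word_of_pos length seq map].
    rewrite map_seq_shift, Pos2Nat.inj_xI; split.
    + intro E; injection E as E0 E.
      destruct (proj1 (IH _) E) as [l Hl].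
      exists (S l); rewrite prefix_number_succ, E0, Hl; cbn; lia.
    + intros [[|l] Hl]; [cbn in Hl; pose proof (Pos2Nat.is_pos u); lia|].
      rewrite prefix_number_succ in Hl.
      destruct (x 0) eqn:E0; cbn [Nat.b2n] in Hl; [|lia].
      f_equal; apply IH; exists l; lia.
  - unfold is_prefix in *; cbn [word_of_pos length seq map].
    rewrite map_seq_shift, Pos2Nat.inj_xO; split.
    + intro E; injection E as E0 E.
      destruct (proj1 (IH _) E) as [l Hl].
      exists (S l); rewrite prefix_number_succ, E0, Hl; cbn; lia.
    + intros [[|l] Hl]; [cbn in Hl; pose proof (Pos2Nat.is_pos u); lia|].
      rewrite prefix_number_succ in Hl.
      destruct (x 0) eqn:E0; cbn [Nat.b2n] in Hl; [lia|].
      f_equal; apply IH; exists l; lia.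
  - split; [|reflexivity].
    intros _; now exists 0.
Qed.

Lemma listed_prefix_iff m x :
  (exists w, listed_word m = Some w /\ is_prefix w x) <->
  exists l, m = prefix_number x l.
Proof.
  unfold listed_word; destruct (N.of_nat m) as [|u] eqn:E.
  - assert (m = 0) as -> by lia; split.
    + intros (w & Hw & _); discriminate.
    + intros [l Hl]; pose proof (prefix_number_positive x l); lia.
  - assert (m = Pos.to_nat u) as -> by lia.
    rewrite <- is_prefix_word_of_pos; split.
    + intros (w & Hw & Hp); now injection Hw as <-.
    + intro Hp; eauto.
Qed.

(** If no stage serves all points, the cylinder of the empty word has no stage,
    and a cylinder without a stage contains one of half its size without a stage.
    The point in the resulting sequence of cylinders contradicts the local
    hypothesis, the argument of Koenig's lemma. *)
Lemma cantor_compact (P : nat -> cantor -> Prop) :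
  (forall x, exists k, forall s y, k <= s -> (forall i, i < k -> y i = x i) -> P s y) ->
  exists s, forall y, P s y.
Proof.
  intro Hloc.
  set (Q w := exists N, forall s y, N <= s -> is_prefix w y -> P s y).
  assert (step : forall w, Q (w ++ [false]) -> Q (w ++ [true]) -> Q w).
  { intros w [M HM] [N HN]; exists (M + N); intros s y Hs Hy.
    assert (Hy' : is_prefix (w ++ [y (length w)]) y).
    { unfold is_prefix in *; rewrite length_app; cbn [length].
      now rewrite Nat.add_1_r, seq_S, map_app, Hy. }
    destruct (y (length w)); [apply HN | apply HM]; (lia || assumption). }
  set (next w := if excluded_middle_informative (Q (w ++ [false])) then true else false).
  set (path := fix path k := match k with 0 => [] | S k => path k ++ [next (path k)] end).
  apply NNPP; intro H.
  assert (bad : forall k, ~ Q (path k)).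
  { induction k as [|k IH]; cbn [path]; fold path.
    - intros [N HN]; apply H; exists N; intro y; apply HN; [lia | reflexivity].
    - unfold next; destruct (excluded_middle_informative _) as [q|q]; [|exact q].
      intro q'; apply IH, step; assumption. }
  destruct (Hloc (fun k => next (path k))) as [k Hk].
  apply (bad k); exists k; intros s y Hs Hy; apply Hk; [exact Hs|].
  assert (E : path k = map (fun k => next (path k)) (seq 0 k)).
  { clear; induction k as [|k IH]; [reflexivity|].
    rewrite seq_S, map_app, <- IH; reflexivity. }
  rewrite E in Hy; exact (is_prefix_map_agree _ _ _ Hy).
Qed.

Lemma bits_of_prefix (x : cantor) s :
  exists w, w < 2 ^ s /\ forall i, i < s -> Nat.testbit w i = x i.
Proof.
  revert x; induction s as [|s IH]; intro x; [exists 0; split; [apply Nat.lt_0_1 | lia]|].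
  destruct (IH (fun k => x (S k))) as (w & Hw & Hb).
  exists (2 * w + Nat.b2n (x 0)); split.
  - rewrite Nat.pow_succ_r'; destruct (x 0); cbn [Nat.b2n]; lia.
  - intros [|i] Hi; [apply Nat.testbit_0_r | rewrite Nat.testbit_succ_r; apply Hb; lia].
Qed.

(** * The search for an approximation of the value *)

(** A test on the approximation, of precision [2^-m], of the distance between
    the dense points [q] and [i]. Writing it without subtraction and division
    makes it a comparison of natural numbers. With the threshold [4 * 2^-m], all
    distances below [3 * 2^-m] pass and no distance from [5 * 2^-m] on does. *)
Definition near (h : nat -> nat) (q i m : nat) : bool :=
  let r := h (npair q (npair i m)) in
  nfst (nfst r) * 2 ^ m <? nsnd (nfst r) * 2 ^ m + 4 * S (nsnd r).

Lemma near_spec h q i m :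
  near h q i m = true <->
  (rational_of_nat (h (npair q (npair i m))) < 4 * (/ 2) ^ m)%R.
Proof.
  unfold near, rational_of_nat; set (r := h _).
  rewrite Nat.ltb_lt, pow_inv.
  assert (P2 : (0 < 2 ^ m)%R) by (apply pow_lt; lra).
  assert (P1 : (0 < INR (nsnd r) + 1)%R) by (pose proof (pos_INR (nsnd r)); lra).
  assert (E2 : INR 2 = 2%R) by (cbn; ring).
  assert (E4 : INR 4 = 4%R) by (cbn; ring).
  assert (EL : forall t, (t / (INR (nsnd r) + 1) * ((INR (nsnd r) + 1) * 2 ^ m))%R
                         = (t * 2 ^ m)%R) by (intro t; field; lra).
  assert (ER : (4 * / 2 ^ m * ((INR (nsnd r) + 1) * 2 ^ m))%R
               = (4 * (INR (nsnd r) + 1))%R) by (field; lra).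
  split; intro L.
  - apply lt_INR in L; rewrite plus_INR, !mult_INR, pow_INR, (S_INR (nsnd r)), E2, E4 in L.
    apply (Rmult_lt_reg_r ((INR (nsnd r) + 1) * 2 ^ m)); [now apply Rmult_lt_0_compat|].
    rewrite EL, ER; lra.
  - apply INR_lt; rewrite plus_INR, !mult_INR, pow_INR, (S_INR (nsnd r)), E2, E4.
    apply (Rmult_lt_compat_r ((INR (nsnd r) + 1) * 2 ^ m)) in L;
      [|now apply Rmult_lt_0_compat].
    rewrite EL, ER in L; lra.
Qed.

(** The first [s] values of the oracle [bpair p (bpair x v)], computed from [x]
    and from the available oracle [o = bpair p v]. *)
Definition partial_oracle (o : baire) (x : cantor) (s j : nat) : nat :=
  if j <? s then S (npair (nfst (o j)) (npair (Nat.b2n (x j)) (nsnd (o j)))) else 0.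

Definition covered (a : baire) (s : nat) (x : cantor) : bool :=
  existsb (fun j => existsb (fun l => a j =? prefix_number x l) (seq 0 (S s))) (seq 0 s).

Definition settled (cK : code) (h : nat -> nat) (m : nat) (o a : baire)
    (i s : nat) (x : cantor) : bool :=
  covered a s x ||
  match beval (partial_oracle o x s) s cK m with
  | 0 => false
  | S q => near h q i m
  end.

Lemma covered_spec a s x :
  covered a s x = true <->
  exists j l, j < s /\ l <= s /\ a j = prefix_number x l.
Proof.
  unfold covered; rewrite existsb_exists; split.
  - intros (j & Hj & H); apply existsb_exists in H as (l & Hl & H).
    apply in_seq in Hj, Hl; apply Nat.eqb_eq in H.
    exists j, l; repeat split; (lia || assumption).
  - intros (j & l & Hj & Hl & H); exists j; split; [apply in_seq; lia|].
    apply existsb_exists; exists l; split; [apply in_seq; lia | now apply Nat.eqb_eq].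
Qed.

Lemma cmpb_near (C : ctx) h (q i m : C -> nat) : computable_nat h ->
  cmp C q -> cmp C i -> cmp C m -> cmpb C (fun e => near h (q e) (i e) (m e)).
Proof.
  intros Hh Hq Hi Hm.
  assert (Hr : cmp C (fun e => h (npair (q e) (npair (i e) (m e))))).
  { apply (cmp_computable_nat C h (fun e => npair (q e) (npair (i e) (m e))) Hh).
    now apply cmp_npair, cmp_npair. }
  unfold near; apply cmpb_ltb.
  - apply cmp_mul; [now apply cmp_nfst, cmp_nfst | now apply cmp_pow2].
  - apply cmp_add.
    + apply cmp_mul; [now apply cmp_nsnd, cmp_nfst | now apply cmp_pow2].
    + apply cmp_mul; [apply cmp_const | now apply cmp_S, cmp_nsnd].
Qed.

Lemma cmp_prefix_number (C : ctx) (w l : C -> nat) :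
  cmp C w -> cmp C l -> cmp C (fun e => prefix_number (Nat.testbit (w e)) (l e)).
Proof.
  intros Hw Hl; unfold prefix_number.
  apply (cmp_rec C (fun _ => 1) l
    (fun e k r => r + 2 ^ k * S (Nat.b2n (Nat.testbit (w e) k))));
    [apply cmp_const | exact Hl |].
  apply cmp_add; [cmp_var|].
  apply cmp_mul; [apply cmp_pow2; cmp_var|].
  apply cmp_S, cmpb_testbit; [cmp_weaken Hw | cmp_var].
Qed.

Lemma cmpb_settled (C : ctx) cK h (a : C -> baire) (m i s w : C -> nat) :
  computable_nat h -> cmp (ext C) (fun e => a (fst e) (snd e)) ->
  cmp C m -> cmp C i -> cmp C s -> cmp C w ->
  cmpb C (fun e =>
    settled cK h (m e) (ctx_oracle C e) (a e) (i e) (s e) (Nat.testbit (w e))).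
Proof.
  intros Hh Ha Hm Hi Hs Hw; unfold settled, covered; apply cmpb_orb.
  - apply (cmpb_existsb C s (fun e j =>
      existsb (fun l => a e j =? prefix_number (Nat.testbit (w e)) l) (seq 0 (S (s e)))));
      [exact Hs|].
    apply (cmpb_existsb (ext C) (fun e => S (s (fst e)))
      (fun e l => a (fst e) (snd e) =? prefix_number (Nat.testbit (w (fst e))) l));
      [apply cmp_S; cmp_weaken Hs|].
    apply cmpb_eqb; [cmp_weaken Ha|].
    apply (cmp_prefix_number (ext (ext C)) (fun e => w (fst (fst e))) (fun e => snd e));
      [cmp_weaken Hw | cmp_var].
  - apply cmp_ext with (fun e =>
      match beval (partial_oracle (ctx_oracle C e) (Nat.testbit (w e)) (s e)) (s e) cK (m e)
      with 0 => 0 | S q => Nat.b2n (near h q (i e) (m e)) end).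
    { intro e; now destruct (beval _ _ _ _). }
    apply (cmp_case C (fun _ => 0)
      (fun e => beval (partial_oracle (ctx_oracle C e) (Nat.testbit (w e)) (s e))
                  (s e) cK (m e))
      (fun e q => Nat.b2n (near h q (i e) (m e)))); [|apply cmp_const|].
    + apply (cmp_call C C (fun e => e) (fun e n =>
        beval (partial_oracle (ctx_oracle C e) (Nat.testbit (w e)) (s e)) (s e) cK n) m);
        [reflexivity | apply cmp_index | | exact Hm].
      apply (cmp_beval C
        (fun e => partial_oracle (ctx_oracle C e) (Nat.testbit (w e)) (s e)) s cK);
        [|exact Hs].
      assert (Ho : cmp (ext C) (fun e => ctx_oracle C (fst e) (snd e)))
        by apply (cmp_oracle (ext C) (fun e => snd e)), cmp_last.
      unfold partial_oracle; apply cmp_if; [| |apply cmp_const].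
      * apply cmpb_ltb; [cmp_var | cmp_weaken Hs].
      * apply cmp_S, cmp_npair; [now apply cmp_nfst|].
        apply cmp_npair; [|now apply cmp_nsnd].
        apply cmpb_testbit; [cmp_weaken Hw | cmp_var].
    + apply (cmpb_near (ext C) h (fun e => snd e)); [exact Hh | cmp_var | |];
        [cmp_weaken Hi | cmp_weaken Hm].
Qed.

Lemma cauchy_names_le (Y : computable_metric_space) q (y : Base Y) m :
  cauchy_names Y q y -> (dist Y (cms_points Y (q m)) y <= (/ 2) ^ m)%R.
Proof.
  intros [Hc Hl]; apply Rnot_lt_le; intro L.
  destruct (Hl (dist Y (cms_points Y (q m)) y - (/ 2) ^ m)%R) as [N HN]; [lra|].
  specialize (HN (S m + N) ltac:(lia)); specialize (Hc (S m + N) m ltac:(lia)).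
  unfold Rdist in HN; rewrite Rminus_0_r in HN; apply Rabs_def2 in HN as [HN _].
  pose proof (dist_tri Y (cms_points Y (q m)) y (cms_points Y (q (S m + N)))) as T.
  rewrite (dist_sym Y (cms_points Y (q m)) (cms_points Y (q (S m + N)))) in T; lra.
Qed.

Lemma half_pow_le i j : j <= i -> ((/ 2) ^ i <= (/ 2) ^ j)%R.
Proof.
  intro L; rewrite !pow_inv.
  apply Rinv_le_contravar; [apply pow_lt; lra | apply Rle_pow; [lra | lia]].
Qed.

(** The extra factor [1/2] makes the rate of convergence to [y] into a rate of
    convergence between the terms of the sequence. *)
Lemma cauchy_names_of_close (Y : computable_metric_space) q (y : Base Y) :
  (forall n, (dist Y (cms_points Y (q n)) y < (/ 2) ^ S n)%R) -> cauchy_names Y q y.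
Proof.
  intro Hq; split.
  - intros i j Hij.
    pose proof (dist_tri Y (cms_points Y (q i)) (cms_points Y (q j)) y) as T.
    rewrite (dist_sym Y y) in T.
    pose proof (half_pow_le i j ltac:(lia)).
    pose proof (Hq i) as Hi; pose proof (Hq j) as Hj; cbn [pow] in *; lra.
  - intros e He.
    destruct (pow_lt_1_zero (/ 2) ltac:(rewrite Rabs_pos_eq; lra) e He) as [N HN].
    exists N; intros n Hn.
    specialize (HN (S n) ltac:(lia)); specialize (Hq n).
    unfold Rdist; rewrite Rminus_0_r, Rabs_pos_eq by apply Rge_le, dist_pos.
    rewrite Rabs_pos_eq in HN by (apply pow_le; lra); lra.
Qed.

Definition name_of (x : cantor) : baire := fun n => Nat.b2n (x n).

Definition uncovered (a : baire) (x : cantor) : Prop :=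
  forall j l, a j <> prefix_number x l.

(** What the reduction to the product provides once [p] and the solution [v] are
    fixed: a non-empty closed set, given by [a], all of whose points lead [cK] to a name
    of the same point [y]. *)
Definition solved_by_choice (Y : computable_metric_space) (cK : code)
    (p a v : baire) (y : Base Y) : Prop :=
  (exists x, uncovered a x) /\
  forall x, uncovered a x -> exists q, cauchy_names Y q y /\
    forall n, eval (bpair p (bpair (name_of x) v)) cK n (q n).

Lemma partial_oracle_value p v x s j :
  j < s ->
  partial_oracle (bpair p v) x s j = S (bpair p (bpair (name_of x) v) j).
Proof.
  intro L; unfold partial_oracle; apply Nat.ltb_lt in L as ->.
  unfold bpair, name_of; now rewrite nfst_npair, nsnd_npair.
Qed.

Definition approximates_dist (Y : computable_metric_space) (h : nat -> nat) : Prop :=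
  forall i j k, (Rabs (rational_of_nat (h (npair i (npair j k)))
    - dist Y (cms_points Y i) (cms_points Y j)) < (/ 2) ^ k)%R.
Lemma near_sound (Y : computable_metric_space) h q i m :
  approximates_dist Y h ->
  near h q i m = true -> (dist Y (cms_points Y q) (cms_points Y i) < 5 * (/ 2) ^ m)%R.
Proof.
  intros Hh N; apply near_spec in N.
  specialize (Hh q i m); apply Rabs_def2 in Hh; lra.
Qed.

Lemma near_complete (Y : computable_metric_space) h q i m :
  approximates_dist Y h ->
  (dist Y (cms_points Y q) (cms_points Y i) < 3 * (/ 2) ^ m)%R -> near h q i m = true.
Proof.
  intros Hh N; apply near_spec.
  specialize (Hh q i m); apply Rabs_def2 in Hh; lra.
Qed.

(** The compactness argument. The dense point is fixed first, within [2^-m] of [y];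
    the [m]-th term of a name of [y] is then within [2 * 2^-m] of it, which
    leaves room for the error of the test. *)
Lemma settled_everywhere (Y : computable_metric_space) cK h m p a v (y : Base Y) :
  approximates_dist Y h ->
  solved_by_choice Y cK p a v y ->
  exists i s, forall x, settled cK h m (bpair p v) a i s x = true.
Proof.
  intros Hh [_ Hsol].
  destruct (cms_dense Y y ((/ 2) ^ m)) as [i Hi]; [apply pow_lt; lra|].
  exists i; apply cantor_compact; intro x.
  destruct (classic (uncovered a x)) as [U|C].
  - destruct (Hsol x U) as (q & Hq & Ev).
    destruct (beval_complete _ _ _ _ (Ev m)) as [k Hk].
    exists k; intros s x' Hs Hx.
    unfold settled; rewrite (Hk s); [|exact Hs|].
    + apply orb_true_iff; right; apply (near_complete Y); [exact Hh|].
      pose proof (cauchy_names_le Y q y m Hq).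
      pose proof (dist_tri Y (cms_points Y (q m)) (cms_points Y i) y) as T.
      assert (0 < (/ 2) ^ m)%R by (apply pow_lt; lra).
      rewrite (dist_sym Y y) in T; lra.
    + intros j Hj; rewrite partial_oracle_value by lia.
      unfold bpair, name_of; now rewrite Hx.
  - assert (C' : exists j l, a j = prefix_number x l).
    { apply NNPP; intro N; apply C; intros j l E; apply N; eauto. }
    destruct C' as (j & l & E).
    exists (S j + l); intros s x' Hs Hx.
    unfold settled; apply orb_true_iff; left; apply covered_spec.
    exists j, l; repeat split; [lia | lia |].
    rewrite E; apply prefix_number_agree; intros k Hk; symmetry; apply Hx; lia.
Qed.

(** One point [x] of the closed set suffices: the word that agrees with [x] up to
    [s] is not covered, so the simulation on it succeeded and agrees with the run
    on [x]. The constant is [5] from the test plus [1] from the name. *)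
Lemma settled_sound (Y : computable_metric_space) cK h m p a v (y : Base Y) i s :
  approximates_dist Y h ->
  solved_by_choice Y cK p a v y ->
  (forall w, w < 2 ^ s -> settled cK h m (bpair p v) a i s (Nat.testbit w) = true) ->
  (dist Y (cms_points Y i) y < 6 * (/ 2) ^ m)%R.
Proof.
  intros Hh [[x U] Hsol] Hs.
  destruct (bits_of_prefix x s) as (w & Hw & Hb).
  destruct (Hsol x U) as (q & Hq & Ev).
  specialize (Hs w Hw); apply orb_true_iff in Hs as [C|Hs].
  - apply covered_spec in C as (j & l & _ & Hl & E).
    exfalso; apply (U j l); rewrite E; apply prefix_number_agree.
    intros k Hk; apply Hb; lia.
  - destruct (beval _ s cK m) as [|r] eqn:Er; [discriminate|].
    assert (r = q m) as ->.
    { eapply eval_functional; [|apply Ev].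
      refine (beval_sound _ _ _ _ _ _ _ Er); intros j b Ej.
      destruct (Nat.ltb_spec j s) as [L|L].
      - rewrite partial_oracle_value in Ej by exact L.
        injection Ej as <-; unfold bpair, name_of; now rewrite Hb.
      - apply Nat.ltb_ge in L; unfold partial_oracle in Ej; rewrite L in Ej; discriminate. }
    apply (near_sound Y _ _ _ _ Hh) in Hs.
    pose proof (cauchy_names_le Y q y m Hq).
    pose proof (dist_tri Y (cms_points Y i) y (cms_points Y (q m))) as T.
    rewrite (dist_sym Y (cms_points Y i) (cms_points Y (q m))) in T; lra.
Qed.

(** The program searches for a pair of a dense point and a stage with
    precision [m = n + 4], since [6 * 2^-(n+4) < 2^-(n+1)]. Of the data it
    reads [p] and [v] only; the stage-by-stage list of words excluded from the
    closed set is recomputed from [p] by [cH]. *)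
Lemma choice_elimination (Y : computable_metric_space) (cH cK : code) :
  exists c, forall p v h y,
    (forall n, eval p cH n (h n)) -> solved_by_choice Y cK p (bfst h) v y ->
    exists q, cauchy_names Y q y /\ forall n, eval (bpair p v) c n (q n).
Proof.
  destruct (cms_computable Y) as (h & Hh & Happ).
  set (env := {d : (baire * baire) * (baire * Base Y) |
    (forall n, eval (fst (fst d)) cH n (fst (snd d) n)) /\
    solved_by_choice Y cK (fst (fst d)) (bfst (fst (snd d))) (snd (fst d)) (snd (snd d))}).
  set (C := {| ctx_env := env;
               ctx_oracle := fun e => bpair (fst (fst (proj1_sig e))) (snd (fst (proj1_sig e)));
               ctx_index := fun _ => 0 |}).
  set (a := fun (e : C) => bfst (fst (snd (proj1_sig e)))).
  assert (Ha : cmp (ext C) (fun e => a (fst e) (snd e))).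
  { exists (Comp Fst (Comp (relativize (Comp Fst Oracle) cH) Snd)).
    intros [[d [Hd Sd]] n]; cbn.
    eexists; split; [|reflexivity].
    eexists; split; [reflexivity|]; rewrite nsnd_npair.
    apply (eval_relativize _ (fst (fst d))); [|apply Hd].
    intro k; cbn; eexists; split; [reflexivity|].
    unfold bpair; now rewrite nfst_npair. }
  destruct (cmp_search (ext C) (fun e t =>
    forallb (fun w => settled cK h (4 + snd e) (ctx_oracle C (fst e)) (a (fst e))
                        (nfst t) (nsnd t) (Nat.testbit w)) (seq 0 (2 ^ nsnd t))))
    as (f & Hf & Spec).
  - apply (cmpb_forallb (ext (ext C)) (fun e => 2 ^ nsnd (snd e)) (fun e w =>
      settled cK h (4 + snd (fst e)) (ctx_oracle C (fst (fst e))) (a (fst (fst e)))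
        (nfst (snd e)) (nsnd (snd e)) (Nat.testbit w)));
      [apply cmp_pow2, cmp_nsnd, cmp_last|].
    apply (cmpb_settled (ext (ext (ext C))) cK h (fun e => a (fst (fst (fst e))))
      (fun e => 4 + snd (fst (fst e))) (fun e => nfst (snd (fst e)))
      (fun e => nsnd (snd (fst e))) (fun e => snd e)); [exact Hh | | | | |].
    + apply (cmp_call C (ext (ext (ext (ext C)))) (fun e => fst (fst (fst (fst e))))
        a (fun e => snd e)); [reflexivity | cmp_weaken (cmp_index C) | exact Ha | apply cmp_last].
    + apply cmp_add; [apply cmp_const | cmp_var].
    + apply cmp_nfst; cmp_var.
    + apply cmp_nsnd; cmp_var.
    + cmp_var.
  - intros [[d [Hd Sd]] n].
    destruct (settled_everywhere Y cK h (4 + n) _ _ _ _ Happ Sd) as (i & s & His).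
    exists (npair i s); rewrite nfst_npair, nsnd_npair.
    apply forallb_forall; intros w _; apply His.
  - destruct (cmp_nfst _ _ Hf) as [c Hc].
    (* In [C] the input is the constant [0], in [ext C] it is [<0, n>]. *)
    exists (Comp c (Pair Zero (Pair Fst Snd))).
    intros p v r y Hr Sr.
    set (e := exist _ ((p, v), (r, y)) (conj Hr Sr) : C).
    exists (fun n => nfst (f (e, n))); split.
    + apply cauchy_names_of_close; intro n.
      pose proof (Spec (e, n)) as Sp; rewrite forallb_forall in Sp.
      assert (D : (dist Y (cms_points Y (nfst (f (e, n)))) y < 6 * (/ 2) ^ (4 + n))%R).
      { apply (settled_sound Y cK h (4 + n) p (bfst r) v y _ (nsnd (f (e, n))) Happ Sr).
        intros w Hw; apply Sp, in_seq; lia. }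
      assert (P : (0 < (/ 2) ^ n)%R) by (apply pow_lt; lra).
      rewrite pow_add in D; cbn [pow] in *; lra.
    + intro n; cbn; exists (npair 0 n); split; [|exact (Hc (e, n))].
      exists 0, n; repeat split.
      exists (nfst n), (nsnd n); repeat split; symmetry; apply npair_surj.
Qed.

(** * Reductions in terms of names *)

Definition realizer_of {X Y : represented_space} (f : multifun X Y) (s : baire -> baire) :
  pfun.
Proof.
  refine {| graph := fun r q => (exists x, names r x /\ mdom f x) /\ q = s r |}.
  intros r q q' [_ ->] [_ ->]; reflexivity.
Defined.

(** Testing a reduction on realizers whose domain consists exactly of the names of
    instances shows that [H p] names an instance. Redefining such a realizer
    at the single input [H p] shows that [K] must handle every
    name of every solution. *)
Lemma weihrauch_inputs {X Y Z W : represented_space} (f : multifun X Y) (g : multifun Z W)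
    (K H : pfun) :
  (forall G : pfun, realizes G g -> realizes (wcomp K G H) f) ->
  forall p x, names p x -> mdom f x ->
  exists h z, H p h /\ names h z /\ mdom g z /\
    forall r w, names r w -> g z w ->
    exists q y, K (bpair p r) q /\ names q y /\ f x y.
Proof.
  intros HW p x Hp Hx.
  set (good s := forall r z, names r z -> mdom g z -> exists w, names (s r) w /\ g z w).
  assert (R : forall s, good s -> realizes (realizer_of g s) g).
  { intros s Hs r z Hr Hz; destruct (Hs r z Hr Hz) as (w & Hw & Gw).
    exists (s r), w; cbn; eauto 6. }
  assert (S0 : exists s, good s).
  { exists (fun r => epsilon (inhabits r) (fun q =>
      forall z, names r z -> exists w, names q w /\ g z w)).
    intros r z Hr [w Hw].
    apply (epsilon_spec (inhabits r) (fun q =>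
      forall z, names r z -> exists w, names q w /\ g z w)); [|exact Hr].
    destruct (names_surjective W w) as [q Hq]; exists q; intros z' Hz'.
    rewrite <- (names_functional Z r z z' Hr Hz'); eauto. }
  destruct S0 as [s0 Hs0].
  destruct (HW _ (R s0 Hs0) p x Hp Hx) as (_ & _ & (h & _ & Hh & [(z & Hz & Dz) _] & _) & _).
  exists h, z; do 3 (split; [assumption|]); intros r w Hr Gw.
  set (s1 := fun b => if excluded_middle_informative (b = h) then r else s0 b).
  assert (Hs1 : good s1).
  { intros b z' Hb Hz'; unfold s1.
    destruct (excluded_middle_informative (b = h)) as [->|_]; [|now apply Hs0].
    rewrite <- (names_functional Z h z z' Hz Hb); eauto. }
  destruct (HW _ (R s1 Hs1) p x Hp Hx) as (q & y & (h' & r' & Hh' & [_ ->] & Kq) & Hq & Fy).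
  rewrite (graph_functional H _ _ _ Hh' Hh) in Kq.
  unfold s1 in Kq; destruct (excluded_middle_informative (h = h)) as [_|N]; [|now destruct N].
  eauto.
Qed.

Theorem theorem5p1 (X Z W : represented_space) (Y : computable_metric_space)
    (g : multifun Z W) (f : multifun X (cauchy_space Y)) :
  single_valued f ->
  weihrauch_le f (multifun_prod closed_choice g) ->
  weihrauch_le f g.
Proof.
  intros Hf (K & H & [cK HK] & [cH HH] & HW).
  destruct (choice_elimination Y cH cK) as [c Hc].
  exists (pfun_of_code c), (pfun_of_code (Comp Snd cH)).
  split; [apply computable_pfun_of_code|].
  split; [apply computable_pfun_of_code|].
  intros G HG p x Hp [y Hy].
  destruct (weihrauch_inputs f _ K H HW p x Hp (ex_intro _ y Hy))
    as (h & [A z] & Hh & (a & b & -> & HA & Hz) & [[u w] [Hu Hw]] & Hval);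
    cbn in HA, Hz, Hu, Hw.
  destruct (HG b z Hz (ex_intro _ w Hw)) as (v & w' & Gv & Hv & Hw').
  assert (HU : forall t, uncovered a t <-> proj1_sig A t).
  { intro t; rewrite (HA t); split.
    - intros U (j & wd & L); destruct (proj1 (listed_prefix_iff (a j) t)) as [l E];
        [eauto | exact (U j l E)].
    - intros N j l E; apply N; exists j; apply listed_prefix_iff; eauto. }
  destruct (Hc p v (bpair a b) y) as (q & Hq & Ev); [apply HH, Hh | |].
  - rewrite bfst_pair; split; [exists u; now apply HU|].
    intros t Ht; apply HU in Ht.
    destruct (Hval (bpair (name_of t) v) (t, w')) as (q & y' & Kq & Hq & Fy').
    + exists (name_of t), v; repeat split; auto.
    + split; assumption.
    + exists q; split; [now rewrite (Hf _ _ _ Hy Fy') | now apply HK].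
  - exists q, y; split; [|split; assumption].
    exists b, v; split; [|split; [exact Gv | exact Ev]].
    intro n; cbn; exists (bpair a b n); split; [apply HH, Hh|].
    unfold bpair; now rewrite nsnd_npair.
Qed.
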